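(* Let $k\ge 3$ and let $G$ be a girth-regular graph of order $n$, valency $k$, even girth $g=2h$ and signature $\mathbf{a}=(a_1,a_2,\ldots,a_k)$. Then $$n\ge 2\frac{(k-1)^h-2}{k-2}+\left\lceil\frac{(k-1)^h-2a_1}{k}\right\rceil.$$
   Context: All graphs are simple, finite and connected, and valency $k>2$ is assumed throughout. For a $k$-regular graph of girth $g$, the signature of a vertex $v$ is the sequence $(a_1,\ldots,a_k)$, listed in non-decreasing order, of the numbers of $g$-cycles containing each of the $k$ edges incident with $v$; the graph is girth-regular if all vertices have the same signature, which is then called the signature of the graph. *)

(* Defs.v *)
From mathcomp Require Import all_boot all_order all_algebra.

Set Implicit Arguments.
Unset Strict Implicit.
Unset Printing Implicit Defensive.

(* A graph is a relation e on a finite type T; its edges are the unordered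
   pairs [set x; y] with e x y. *)

Definition simple_graph (T : finType) (e : rel T) : Prop :=
  symmetric e /\ irreflexive e.

Definition connected_graph (T : finType) (e : rel T) : Prop :=
  forall x y : T, connect e x y.

Definition neighbours (T : finType) (e : rel T) (v : T) : {set T} :=
  [set w | e v w].

Definition regular (T : finType) (e : rel T) (k : nat) : Prop :=
  forall v : T, #|neighbours e v| = k.

Definition cycle_edges (T : finType) (c : seq T) : {set {set T}} :=
  [set [set x; next c x] | x in c].

(* Cycles are counted as subgraphs, hence identified with their edge sets, so
   that the choice of starting point and direction is irrelevant.  The bound
   2 < g is needed because [:: x; y] satisfies ucycleb e as soon as e x y. *)
Definition cycles (T : finType) (e : rel T) (g : nat) : {set {set {set T}}} :=
  [set cycle_edges t | t : g.-tuple T & (2 < g) && ucycleb e t].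

Definition is_girth (T : finType) (e : rel T) (g : nat) : Prop :=
  cycles e g != set0 /\ (forall m : nat, m < g -> cycles e m = set0).

Definition cycles_through (T : finType) (e : rel T) (g : nat) (d : {set T}) :
    nat :=
  #|[set C in cycles e g | d \in C]|.

(* Here and below, g is meant to be the girth of e. *)
Definition signature (T : finType) (e : rel T) (g : nat) (v : T) : seq nat :=
  sort leq [seq cycles_through e g [set v; w] | w <- enum (neighbours e v)].

Definition girth_regular (T : finType) (e : rel T) (g : nat) : Prop :=
  forall u v : T, signature e g u = signature e g v.

Definition has_signature (T : finType) (e : rel T) (g : nat) (a : seq nat) :
    Prop :=
  forall v : T, signature e g v = a.

(* Main.v *)
(* Take an edge [uv] lying on [a1] girth cycles.  Below half the girth the
   non-backtracking walks starting with the arc [vu] or [uv] end at pairwise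
   distinct vertices, which gives two disjoint trees with
   [2 ((k-1)^h - 1) / (k-2)] vertices altogether.  Of the [(k-1)^h] edges leaving
   the outer layer of the tree at [u], those ending in the other tree end in its
   outer layer and close distinct girth cycles through [uv], so there are at
   most [a1] of them.  The others end outside both trees, where each vertex
   absorbs at most [k] of them. *)

Require Import Defs.
From mathcomp Require Import all_boot all_order all_algebra.
From mathcomp Require Import zify lra.

Set Implicit Arguments.
Unset Strict Implicit.
Unset Printing Implicit Defensive.

Import Order.TTheory GRing.Theory Num.Theory.
Local Open Scope ring_scope.

(** * Non-backtracking walks *)

Section NonBacktracking.

Local Open Scope nat_scope.

Variables (T : finType) (e : rel T).
Hypotheses (esym : symmetric e) (eirr : irreflexive e).

Fixpoint nbwalk (s : seq T) : bool :=
  if s is x :: s' then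
    (if s' is y :: s'' then e x y && (ohead s'' != Some x) else true) &&
    nbwalk s'
  else true.

(** Backtracking involves only three consecutive vertices, so walks glue along a common arc. *)
Lemma nbwalk_cat2 s x y t :
  nbwalk (s ++ x :: y :: t) = nbwalk (s ++ [:: x; y]) && nbwalk (x :: y :: t).
Proof.
elim: s => [|a s IHs]; first by rewrite /= !andbT; case: (e x y).
rewrite !cat_cons /= -/nbwalk in IHs *; rewrite IHs andbA.
by case: s {IHs} => [|b [|c s]].
Qed.

Lemma nbwalk_rev s : nbwalk (rev s) = nbwalk s.
Proof.
elim: s => // x [|y [|z s]] // IHs; first by rewrite /rev /= esym.
rewrite !rev_cons -!cats1 -!catA /= nbwalk_cat2.
move: IHs; rewrite !rev_cons -!cats1 -!catA /= => ->.
rewrite (esym z y) (esym y x) !(inj_eq Some_inj) (eq_sym z x).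
by case: (e y z); case: (e x y); case: (x == z); rewrite /= ?andbF ?andbT.
Qed.

Lemma nbwalk_sorted s : nbwalk s -> sorted e s.
Proof.
elim: s => // x [|y s] // IHs; rewrite [nbwalk _]/= => /andP[/andP[exy _] /IHs].
by rewrite /= exy.
Qed.

Lemma nbwalk_catl s t : nbwalk (s ++ t) -> nbwalk s.
Proof.
elim: s => // x s IHs; rewrite cat_cons /= => /andP[+ /IHs ->].
by case: s {IHs} => [|y [|z s]] //=; rewrite ?andbT // => /andP[->].
Qed.

(** * Uniqueness of short walks and the layers around an edge *)

Variable h : nat.
Hypothesis girth_ge : forall m, m < h.*2 -> cycles e m = set0.

(* The first return of a non-backtracking walk to a vertex closes a cycle. *)
Lemma nbwalk_uniq s : nbwalk s -> size s <= h.*2 -> uniq s.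
Proof.
elim: s => // x s IHs nbs; rewrite /= => lt_s.
have /IHs/(_ (ltnW lt_s)) uniq_s : nbwalk s by case/andP: nbs.
rewrite uniq_s andbT; apply/negP => xs.
case/splitPr: {2}s / xs (erefl s) => p1 p2 def_s.
pose c := rcons p1 x.
have def_c : s = c ++ p2 by rewrite /c cat_rcons.
have size_c : size c < h.*2.
  by apply: leq_trans lt_s; rewrite def_c size_cat ltnS leq_addr.
have nbc : nbwalk (x :: c) by apply: (@nbwalk_catl _ p2); rewrite cat_cons -def_c.
have cycle_c : cycle e c.
  rewrite /c -rot1_cons -[X in cycle e X]/(rot 1 (x :: p1)) rot_cycle /=.
  exact: nbwalk_sorted nbc.
have uniq_c : uniq c by move: uniq_s; rewrite def_c cat_uniq => /andP[].
(* With fewer than two vertices in [p1], the return to [x] would be a loop or a backtrack. *)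
have gt2 : 2 < size c.
  move: nbc; rewrite /c; case: (p1) => [|a [|b p]] /=; rewrite ?eirr ?eqxx ?andbF //.
  by rewrite size_rcons.
have /setP/(_ (cycle_edges c)) := girth_ge size_c.
rewrite inE => /imsetP[]; exists (in_tuple c) => //.
by rewrite inE gt2 /ucycleb cycle_c uniq_c.
Qed.

(** Once the common prefix is stripped, the reverse of one walk followed by the other is
    non-backtracking, has at most [h.*2] vertices and repeats its end, against [nbwalk_uniq]. If one
    walk runs out first, the other already returns to [x]. *)
Lemma nbwalk_inj x p q : nbwalk (x :: p) -> nbwalk (x :: q) ->
  last x p = last x q -> size p + size q < h.*2 -> p = q.
Proof.
elim: p x q => [|a p IHp] x [|b q] //.
- move=> _ nbq eq_last lt_q.
  by have := nbwalk_uniq nbq lt_q; rewrite cons_uniq [x]eq_last (mem_last b q).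
- move=> nbp _ eq_last; rewrite addn0 => lt_p.
  by have := nbwalk_uniq nbp lt_p; rewrite cons_uniq -[x in x \in _]eq_last (mem_last a p).
move=> nbp nbq eq_last lt_pq; have [eq_ab|ne_ab] := eqVneq a b.
  subst b; congr (_ :: _); apply: (IHp a) => //.
  - by case/andP: nbp.
  - by case/andP: nbq.
  by move: lt_pq => /=; lia.
have nbs : nbwalk (rev p ++ [:: a, x, b & q]).
  rewrite nbwalk_cat2; apply/andP; split.
    by rewrite -nbwalk_rev rev_cat revK.
  move: (nbp) => /= /andP[/andP[exa _] _].
  rewrite [nbwalk _]/= in nbq *; rewrite nbq esym exa /= (inj_eq Some_inj).
  by rewrite eq_sym ne_ab.
have := nbwalk_uniq nbs.
rewrite size_cat size_rev /= in lt_pq *.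
have -> : rev p ++ [:: a, x, b & q] = rev (a :: p) ++ [:: x, b & q].
  by rewrite rev_cons cat_rcons.
rewrite cat_uniq => uniq_s; have /uniq_s/and3P[_ /hasPn/(_ (last b q))] :
    size p + (size q).+3 <= h.*2 by lia.
rewrite in_cons mem_last orbT mem_rev => /(_ isT).
by rewrite -[last b q]eq_last (mem_last a p).
Qed.

(* If [e x y] and [i < h], these are the vertices at distance [i] from [y] and
   [i.+1] from [x]. *)
Definition sphere (i : nat) (x y : T) : {set T} :=
  [set last y p | p : i.-tuple T & nbwalk (x :: y :: p)].

Lemma sphereP i x y w :
  reflect (exists p, [/\ size p = i, nbwalk (x :: y :: p) & last y p = w])
    (w \in sphere i x y).
Proof.
apply: (iffP imsetP) => [[p + ->]|[p [size_p nbp <-]]].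
  by rewrite inE; exists p; rewrite size_tuple.
by move/eqP: size_p => size_p; exists (Tuple size_p); rewrite ?inE.
Qed.

Lemma sphere_disjoint i j x y w : w \in sphere i x y -> w \in sphere j x y ->
  i + j < h.*2 -> i = j.
Proof.
move=> /sphereP[p [<- /andP[_ nbp] <-]] /sphereP[q [<- /andP[_ nbq] eq_last]] lt.
by rewrite (nbwalk_inj nbp nbq).
Qed.

(** The first walk, read from [y], has length [i.+1]; hence the bound is one less than in
    [sphere_disjoint]. Uniqueness would make the second walk begin with [x], [y], [x]. *)
Lemma sphere_opposite i j x y w : e x y ->
  w \in sphere i y x -> w \in sphere j x y -> i + j < h.*2.-1 -> False.
Proof.
move=> exy /sphereP[p [<- nbp <-]] /sphereP[q [<- nbq eq_last]] lt.
have nbq' : nbwalk (y :: q) by case/andP: nbq.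
have def_q : x :: p = q by apply: (nbwalk_inj nbp nbq') => //=; lia.
by move: nbq; rewrite -def_q /= eqxx andbF.
Qed.

Lemma card_bigcup_disjoint (I : finType) (P : pred I) (F : I -> {set T}) :
  (forall i j, P i -> P j -> i != j -> [disjoint F i & F j]) ->
  #|\bigcup_(i | P i) F i| = \sum_(i | P i) #|F i|.
Proof.
move=> disjF; rewrite big_mkcond [RHS]big_mkcond -sum1_card /=.
rewrite partition_disjoint_bigcup => [|i j ne_ij].
  by apply: eq_bigr => i _; case: ifP => _; rewrite sum1_card ?cards0.
case: ifP => Pi; last by rewrite disjoints_subset sub0set.
by case: ifP => Pj; [exact: disjF | rewrite disjoint_sym disjoints_subset sub0set].
Qed.

(** * Sizes of the layers and of the two trees *)

Variable k : nat.
Hypothesis ereg : regular e k.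

Lemma card_neighboursD1 x y : e x y -> #|neighbours e y :\ x| = k.-1.
Proof.
by move=> exy; have := cardsD1 x (neighbours e y); rewrite ereg inE esym exy; lia.
Qed.

(** Walks are sorted by the vertex [z] that follows [y]; different choices of [z] never reach the
    same vertex, by [nbwalk_inj]. *)
Lemma card_sphere i x y : e x y -> i < h -> #|sphere i x y| = k.-1 ^ i.
Proof.
elim: i x y => [|i IHi] x y exy lt_i.
  rewrite expn0; apply/eqP/cards1P; exists y; apply/setP => w.
  rewrite inE; apply/sphereP/eqP => [[[|a p] [// _ _ <-]]|->] //.
  by exists [::]; rewrite /= exy.
have -> : sphere i.+1 x y = \bigcup_(z in neighbours e y :\ x) sphere i y z.
  apply/setP => w; apply/sphereP/bigcupP => [[[|z p] [//] [<-] nbp <-]|[z]].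
    exists z; last by apply/sphereP; exists p; split=> //; case/andP: nbp.
    by move: nbp => /= /and3P[/andP[_]]; rewrite !inE => -> /andP[-> _].
  rewrite !inE => /andP[ne_zx eyz] /sphereP[p [<- nbp <-]].
  exists (z :: p); split=> //.
  by apply/andP; split; rewrite // exy /= (inj_eq Some_inj).
rewrite card_bigcup_disjoint => [|z z' _ _ ne_zz'].
  rewrite (eq_bigr (fun=> k.-1 ^ i)) => [|z]; last first.
    by rewrite !inE => /andP[_ eyz]; rewrite IHi // ltnW.
  by rewrite sum_nat_const card_neighboursD1 // expnS.
rewrite -setI_eq0; apply/eqP/setP => w; rewrite !inE; apply/negP.
move=> /andP[/sphereP[p [size_p nbp eq_p]] /sphereP[q [size_q nbq eq_q]]].
have [] : z :: p = z' :: q.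
  by apply: (nbwalk_inj nbp nbq); rewrite /= ?eq_p ?eq_q ?size_p ?size_q //; lia.
by move/eqP; rewrite (negPf ne_zz').
Qed.

(** For an edge [xy], this is the tree rooted at [y] and directed away from [x], with outer layer
    [sphere h.-1 x y]. *)
Definition ball x y : {set T} := \bigcup_(i < h) sphere i x y.

Lemma card_ball x y : e x y -> #|ball x y| = \sum_(i < h) k.-1 ^ i.
Proof.
move=> exy; rewrite card_bigcup_disjoint => [|i j _ _ ne_ij].
  by apply: eq_bigr => i _; rewrite card_sphere.
rewrite -setI_eq0; apply/eqP/setP => w; rewrite !inE; apply/negP => /andP[wi wj].
case/eqP: ne_ij; apply/val_inj/(sphere_disjoint wi wj).
by have := ltn_ord i; have := ltn_ord j; lia.
Qed.

Lemma ball_disjoint x y : e x y -> [disjoint ball y x & ball x y].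
Proof.
move=> exy; rewrite -setI_eq0; apply/eqP/setP => w; rewrite !inE; apply/negP.
move=> /andP[/bigcupP[i _ wi] /bigcupP[j _ wj]].
by apply: (sphere_opposite exy wi wj); have := ltn_ord i; have := ltn_ord j; lia.
Qed.

(** * Girth cycles closed by edges between the outer layers *)

(** Cycles are stored as edge sets, so [cover] is the way back to their vertices. *)
Lemma cover_cycle_edges (c : seq T) : cover (cycle_edges c) = [set x in c].
Proof.
apply/setP => x; rewrite inE; apply/bigcupP/idP => [[_ /imsetP[y yc ->]]|xc].
  by rewrite !inE => /orP[] /eqP-> //; rewrite mem_next.
by exists [set x; next c x]; [exact: imset_f | rewrite !inE eqxx].
Qed.

Hypothesis h_gt1 : 1 < h.

Lemma nbwalk_prefix x y p w : nbwalk (x :: y :: p) -> w \in y :: p ->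
  exists2 i, i <= size p & w \in sphere i x y /\ (i = size p -> w = last y p).
Proof.
move=> nbp wp; case/splitPl: p / wp nbp => p1 p2 <- nbp.
exists (size p1); first by rewrite size_cat leq_addr.
split; first by apply/sphereP; exists p1; split=> //; apply: (@nbwalk_catl _ p2).
move=> /eqP; rewrite size_cat -{1}[size p1]addn0 eqn_add2l eq_sym => /eqP/size0nil->.
by rewrite cats0.
Qed.

(** The vertices of [y :: p] lie in successive layers of one tree, so only the last is in the outer
    layer; those of [x :: q] lie in the opposite tree. *)
Lemma nbwalk_sphereI x y p q : e x y ->
  nbwalk (x :: y :: p) -> nbwalk (y :: x :: q) ->
  size p = h.-1 -> size q = h.-1 ->
  sphere h.-1 x y :&: [set w in (y :: p) ++ (x :: q)] = [set last y p].
Proof.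
move=> exy nbp nbq size_p size_q; apply/setP => w; rewrite in_setI in_set in_set1.
rewrite mem_cat; apply/andP/eqP => [[ws /orP[wp|wq]]|->].
- have [i le_i [wi eq_w]] := nbwalk_prefix nbp wp; rewrite size_p in le_i eq_w.
  by apply: eq_w; apply: (sphere_disjoint wi ws); lia.
- have [i le_i [wi _]] := nbwalk_prefix nbq wq; rewrite size_q in le_i.
  by case: (sphere_opposite exy wi ws); lia.
by rewrite mem_last; split=> //; apply/sphereP; exists p.
Qed.

(* The two intersections show that the cycle determines the edge [wx]. *)
Lemma outer_edge_cycle u v w x : e u v ->
  w \in sphere h.-1 v u -> x \in sphere h.-1 u v -> e w x ->
  exists C, [/\ C \in cycles e h.*2, [set u; v] \in C,
    sphere h.-1 v u :&: cover C = [set w] & sphere h.-1 u v :&: cover C = [set x]].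
Proof.
move=> euv ws xs ewx.
have /sphereP[p [size_p nbp last_p]] := ws.
have /sphereP[q [size_q nbq last_q]] := xs.
(* [s] runs from [w] through the arc [uv] to [x] and serves to show that the vertices are distinct;
   its rotation [t] starts at [u], which exposes the edge [uv]. *)
pose s := rev p ++ [:: u, v & q].
pose t := [:: u, v & q] ++ rev p.
have nbs : nbwalk s.
  by rewrite nbwalk_cat2 nbq andbT -[_ ++ _]revK nbwalk_rev rev_cat revK.
have rot_s : t = rot (size (rev p)) s by rewrite rot_size_cat.
have size_t : size t == h.*2.
  by rewrite size_cat /= size_rev size_p size_q; apply/eqP; lia.
have uniq_t : uniq t.
  rewrite rot_s rot_uniq; apply: nbwalk_uniq => //.
  by rewrite -(size_rot (size (rev p))) -rot_s (eqP size_t).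
have cycle_t : cycle e t.
  rewrite /t cat_cons /= euv /= rcons_cat cat_path.
  have /= /andP[_ ->] := nbwalk_sorted nbq.
  (* The return from [x] to [u] is read backwards: from [u] along [p] to [w], then the edge [wx]. *)
  rewrite last_q -rev_cons -(belast_rcons u p x) -{1}(last_rcons u p x) rev_path.
  rewrite (@eq_path _ _ e) => [|a b]; last by rewrite esym.
  by rewrite rcons_path last_p ewx andbT; case/andP: (nbwalk_sorted nbp).
have cover_t : cover (cycle_edges t) = [set a in (u :: p) ++ (v :: q)].
  rewrite cover_cycle_edges; apply/setP => a; rewrite !inE !mem_cat mem_rev !inE.
  by do !bool_congr.
have cover_t' : cover (cycle_edges t) = [set a in (v :: q) ++ (u :: p)].
  by rewrite cover_t; apply/setP => a; rewrite !in_set !mem_cat orbC.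
exists (cycle_edges t); split.
- apply/imsetP; exists (Tuple size_t) => //.
  by rewrite inE /ucycleb; apply/and3P; split=> //; lia.
- apply/imsetP; exists u; first by rewrite inE eqxx.
  by rewrite /t /= eqxx.
- by rewrite cover_t -last_p nbwalk_sphereI // esym.
- by rewrite cover_t' -last_q nbwalk_sphereI.
Qed.

(** Here [z] is the predecessor of [w] on a walk; a step to any other neighbour does not
    backtrack. *)
Lemma sphere_extend i x y w : w \in sphere i.+1 x y ->
  exists z, forall a, e w a -> a != z -> a \in sphere i.+2 x y.
Proof.
case/sphereP=> p [size_p + <-]; case/lastP: p size_p => // p {}w.
rewrite size_rcons last_rcons -rcons_cons => -[size_p].
case/lastP def_p: (y :: p) => // [s z].
rewrite -cats1 -cats1 -catA -cat_cons => nbp.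
exists z => a ewa ne_az; apply/sphereP; exists (rcons (rcons p w) a).
rewrite !size_rcons size_p last_rcons; split=> //.
rewrite -[y :: _]/(rcons (rcons (y :: p) w) a) def_p -!cats1 -!catA -cat_cons.
rewrite (nbwalk_cat2 (x :: s) z w [:: a]) nbp /= ewa (inj_eq Some_inj) ne_az !andbT.
have := nbwalk_sorted nbp; rewrite cat_cons /= cat_path => /andP[_ /=].
by rewrite andbT => /andP[].
Qed.

(** * Double counting of the edges that leave an outer layer *)

Lemma sum_card_neighbours (A B : {set T}) :
  \sum_(w in A) #|neighbours e w :&: B| = \sum_(w in A) \sum_(x in B) e w x.
Proof.
apply: eq_bigr => w _; rewrite -sum1_card [RHS]big_mkcond [LHS]big_mkcond /=.
by apply: eq_bigr => x _; rewrite !inE; case: (e w x); case: (x \in B).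
Qed.

Lemma outer_edges_le_cycles_through u v : e u v ->
  \sum_(w in sphere h.-1 v u) #|neighbours e w :&: sphere h.-1 u v|
    <= cycles_through e h.*2 [set u; v].
Proof.
move=> euv; set A := sphere _ v u; set B := sphere _ u v.
(* Instead of choosing a cycle for each edge, [ends] reads an edge off each cycle, and its image
   contains all edges between the outer layers. On the cycles of [outer_edge_cycle] both
   intersections are singletons, so the default [u] does not occur there. *)
pose ends (C : {set {set T}}) : T * T :=
  (odflt u [pick w in A :&: cover C], odflt u [pick x in B :&: cover C]).
rewrite sum_card_neighbours pair_big /=.
rewrite (eq_bigr (fun p => if e p.1 p.2 then 1 else 0)) => [|p _]; last first.
  by case: (e _ _).
rewrite -big_mkcondr sum1dep_card.
apply: leq_trans (leq_imset_card ends _); apply/subset_leq_card/subsetP => -[w x].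
rewrite inE /= => /andP[/andP[wA xB] ewx].
have [C [Ccyc Cuv CA CB]] := outer_edge_cycle euv wA xB ewx.
apply/imsetP; exists C; first by rewrite inE Ccyc.
rewrite /ends CA CB; congr (_, _).
  by case: pickP => [a|/(_ w)]; rewrite !inE ?eqxx // => /eqP.
by case: pickP => [a|/(_ x)]; rewrite !inE ?eqxx // => /eqP.
Qed.

(** All neighbours of [w] but its predecessor are in [sphere h v u], which misses every layer of
    both trees except possibly the outer layer at [v]. *)
Lemma outer_neighbours u v w : e u v -> w \in sphere h.-1 v u ->
  k.-1 <= #|neighbours e w :&: ~: (ball v u :|: ball u v)|
          + #|neighbours e w :&: sphere h.-1 u v|.
Proof.
move=> euv ws; have [z zP] : exists z,
    forall a, e w a -> a != z -> a \in sphere h v u.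
  have def_h : h = h.-2.+2 by lia.
  by rewrite {1}def_h; apply: sphere_extend; rewrite def_h in ws.
apply: leq_trans (leq_card_setU _ _).
have : k.-1 <= #|neighbours e w :\ z|.
  by have := cardsD1 z (neighbours e w); rewrite ereg; case: (z \in _); lia.
move/leq_trans; apply; apply/subset_leq_card/subsetP => a.
rewrite !inE => /andP[ne_az ewa]; rewrite ewa /=.
have as_ := zP a ewa ne_az.
apply/orP; have [aB|aB] := boolP (a \in sphere h.-1 u v).
  by right.
left; apply/norP; split; apply/bigcupP => -[i _ ai]; have := ltn_ord i.
  by have := sphere_disjoint as_ ai; lia.
have [def_i|ne_i] := eqVneq (i : nat) h.-1; first by rewrite def_i (negPf aB) in ai.
by case: (sphere_opposite euv as_ ai); have := ltn_ord i; lia.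
Qed.

Lemma excess_bound u v : e u v ->
  k.-1 ^ h <= k * #|~: (ball v u :|: ball u v)|
              + cycles_through e h.*2 [set u; v].
Proof.
move=> euv; have h_gt0 := ltnW h_gt1.
rewrite -(prednK h_gt0) expnSr prednK // -(@card_sphere _ v u) //; last 2 first.
- by rewrite esym.
- by rewrite prednK.
rewrite -sum_nat_const.
set O := ~: _.
(* The sum is exchanged so that these edges are counted from their ends in [O]. *)
have le_O : \sum_(w in sphere h.-1 v u) #|neighbours e w :&: O| <= k * #|O|.
  rewrite sum_card_neighbours exchange_big /= mulnC -sum_nat_const.
  apply: leq_sum => x _; rewrite -(ereg x) -sum1_card [leqRHS]big_mkcond.
  rewrite [leqLHS]big_mkcond; apply: leq_sum => w _; rewrite inE esym.
  by case: ifP => _ //; case: (e x w).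
apply: leq_trans (leq_add le_O (outer_edges_le_cycles_through euv)).
rewrite -big_split; apply: leq_sum => w ws; exact: outer_neighbours.
Qed.

End NonBacktracking.

Theorem theorem4p1 (T : finType) (e : rel T) (n k g h : nat) (a : k.-tuple nat)
    (hk : (3 <= k)%N)
    (hsimple : simple_graph e)
    (hconn : connected_graph e)
    (hn : #|T| = n)
    (hreg : regular e k)
    (hgirth : is_girth e g)
    (hg : g = (2 * h)%N)
    (hgr : girth_regular e g)
    (ha : has_signature e g a) :
  let a1 : nat := head 0%N a in
  (2%:R * (((k%:R - 1) ^+ h - 2%:R) / (k%:R - 2%:R))
     + (Num.ceil (((k%:R - 1) ^+ h - 2%:R * a1%:R) / k%:R : rat))%:~R : rat)
  <= n%:R.
Proof.
cbv zeta; set a1 := head _ _; have [esym eirr] := hsimple; rewrite mul2n in hg; subst g.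
have [/set0Pn[_ /imsetP[t]] + _ girth_ge] := hgirth.
rewrite inE => /andP[gt2 _].
have h_gt1 : (1 < h)%N by lia.
have [v _] : exists v, v \in tval t.
  case: (tval t) (size_tuple t) => [/= size_t|v s]; first by lia.
  by exists v; exact: mem_head.
(* Since [a] is nonempty, its head is one of the entries of the signature at [v], hence the count of
   some edge there. *)
have [w evw a1E] : exists2 w, e v w & a1 = cycles_through e h.*2 [set v; w].
  have a1a : a1 \in tval a.
    rewrite /a1; case: (tval a) (size_tuple a) => [/= size_a|b s]; first by lia.
    by rewrite /= mem_head.
  move: a1a; rewrite -(ha v) mem_sort => /mapP[w].
  by rewrite mem_enum inE; exists w.
have := excess_bound esym eirr girth_ge hreg h_gt1 evw.
set W := ball e h w v :|: ball e h v w; set O := ~: W; rewrite -a1E => bound.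
have ewv : e w v by rewrite esym.
have cardW : #|W| = (\sum_(i < h) k.-1 ^ i).*2.
  rewrite cardsU (_ : _ :&: _ = set0) ?cards0 ?subn0.
    by rewrite !(card_ball esym eirr girth_ge hreg) // addnn.
  apply/eqP; rewrite setI_eq0.
  by have := ball_disjoint esym eirr girth_ge evw; rewrite disjoint_sym.
have nE : n = (#|W| + #|O|)%N by rewrite -hn cardsC.
have k1E : k.-1%:R = k%:R - 1 :> rat by rewrite -subn1 natrB //; lia.
have k2_gt0 : 0 < k%:R - 2%:R :> rat by rewrite subr_gt0 ltr_nat.
have k_gt0 : 0 < k%:R :> rat by rewrite ltr0n; lia.
rewrite nE natrD; apply: lerD.
  rewrite mulrA ler_pdivrMr // cardW -muln2 natrM natr_sum.
  under eq_bigr do rewrite natrX k1E.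
  (* The geometric sum gives [#|W| * (k - 2) = 2 * ((k - 1) ^ h - 1)], which exceeds the required
     numerator by 2. *)
  have := subrX1 (k%:R - 1 : rat) h; lra.
rewrite -[leRHS]/((#|O| : int)%:~R) ler_int ceil_le_int ler_pdivrMr //.
have : k.-1%:R ^+ h <= (k * #|O| + a1)%:R :> rat by rewrite -natrX ler_nat.
have : 0 <= a1%:R :> rat by [].
by rewrite natrD natrM k1E -pmulrn; lra.
Qed.
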